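(* Suppose that each $f_i$ ($i\in\mathcal I$) is convex and $L$-smooth for some $L\in(0,+\infty)$, and that $\sigma_*^2<+\infty$. Let $\gamma>0$ with $\gamma L=1$, let $x_0\in\mathcal H$, let $(x_t)_{t\ge 0}$ be generated by SGD with step-size $\gamma$, and let $x_*\in\operatorname{argmin} f$. Then, for every $\varepsilon\in(0,1)$ and every integer $T\ge1$, with $\bar x_T=\frac1T\sum_{t=0}^{T-1}x_t$, $$\mathbb E\left[f(\bar x_T)-\min f\right]\le\frac1T\sum_{t=0}^{T-1}\mathbb E\left[f(x_t)-\min f\right]\le\frac{\|x_0-x_*\|^2}{2(1-\varepsilon)\gamma T}+\frac{1+\varepsilon}{2\varepsilon(1-\varepsilon)}\gamma\sigma_*^2.$$
   Context: Problem setting: $\mathcal H$ is a real Hilbert space, $\mathcal D$ is a probability distribution over a (possibly infinite) index set $\mathcal I$, and $(f_i)_{i\in\mathcal I}$ is a family of differentiable functions $f_i:\mathcal H\to\mathbb R$. For every $x\in\mathcal H$, $i\mapsto f_i(x)$ is $\mathcal D$-measurable with finite expectation; $f(x):=\mathbb E_{i\sim\mathcal D}[f_i(x)]$; $\operatorname{argmin} f\neq\emptyset$; $f$ is differentiable and $\nabla f(x)=\mathbb E[\nabla f_i(x)]$. A function is $L$-smooth if its gradient is $L$-Lipschitz continuous. The solution gradient variance is $\sigma_*^2:=\inf_{x_*\in\operatorname{argmin} f}\mathbb E\left[\|\nabla f_i(x_* )\|^2\right]$. SGD with step-size $\gamma$: $x_{t+1}=x_t-\gamma\nabla f_{i_t}(x_t)$,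 where $x_0\in\mathcal H$ is deterministic and the $i_t$ are i.i.d. with law $\mathcal D$. *)

(* Defs.v *)
From HB Require Import structures.
From mathcomp Require Import all_boot all_order all_algebra.
From mathcomp Require Import finmap.
From mathcomp Require Import all_classical all_reals all_analysis.

Set Implicit Arguments.
Unset Strict Implicit.
Unset Printing Implicit Defensive.

Import Order.TTheory GRing.Theory Num.Theory.
Import numFieldNormedType.Exports.

Local Open Scope classical_set_scope.
Local Open Scope ring_scope.

Section Gradient.
Context {R : realType} {H : completeNormedModType R}.

(* [H] with a dot product is a real Hilbert space when its (complete) norm is
   the one induced by the dot product. *)
Definition hilbert_dot (dot : {dot H for idfun}) : Prop :=
  forall x : H, `|x| ^+ 2 = dot x x.

(* The Riesz representative of the differential; it exists and is unique on a
   Hilbert space as soon as [differentiable f x]. Otherwise the value is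
   meaningless. *)
Definition grad (dot : {dot H for idfun}) (f : H -> R) (x : H) : H :=
  xget 0 [set v | forall h, 'd f x h = dot v h].

Definition smooth (dot : {dot H for idfun}) (L : R) (f : H -> R) : Prop :=
  (forall x, differentiable f x) /\ L.-lipschitz (grad dot f).

Definition argmin (f : H -> R) : set H := [set x | forall y, f x <= f y].

(* Only meaningful for [f] bounded from below; it is attained when
   [argmin f !=set0]. *)
Definition minval (f : H -> R) : R := inf (range f).

End Gradient.

Section Bochner.
Context {d : measure_display} {T : measurableType d} {R : realType}.
Context {V : normedModType R}.

(* [V] carries no sigma-algebra: a finitely-valued function is measurable when
   its fibers are. *)
Definition vsimple (s : T -> V) : Prop :=
  finite_set (range s) /\ forall v, measurable (s @^-1` [set v]).

Definition vsimple_expectation (P : probability T R) (s : T -> V) : V :=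
  \sum_(v \in range s) fine (P (s @^-1` [set v])) *: v.

(* [g] is Bochner integrable with Bochner integral [m]: [g] is the almost sure
   and L^1 limit of simple functions, whose expectations converge to [m]. *)
Definition bochner_expectation (P : probability T R) (g : T -> V) (m : V)
    : Prop :=
  exists s : nat -> T -> V,
    [/\ forall n, vsimple (s n),
        {ae P, forall w, (fun n => s n w) @ \oo --> g w},
        (fun n => 'E_P[fun w => `|s n w - g w|%R])%E @ \oo --> 0%E &
        (fun n => vsimple_expectation P (s n)) @ \oo --> m].

End Bochner.

Definition iid {d d' : measure_display} {Om : measurableType d}
    {I : measurableType d'} {R : realType} (P : probability Om R)
    (D : probability I R) (idx : nat -> {RV P >-> I}) : Prop :=
  (forall t (B : set I), measurable B -> distribution P (idx t) B = D B) /\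
  (forall (J : {fset nat}) (B : nat -> set I), (forall t, measurable (B t)) ->
    P (\bigcap_(t in [set` J]) (idx t @^-1` B t)) =
    (\prod_(t <- J) P (idx t @^-1` B t))%E).

Section SGD.
Context {d' : measure_display} {I : measurableType d'} {R : realType}.
Context {H : completeNormedModType R}.

Definition expected_fun (D : probability I R) (fi : I -> H -> R) (x : H) : R :=
  fine 'E_D[fun i => fi i x]%E.

Definition solution_gradient_variance (dot : {dot H for idfun})
    (D : probability I R) (fi : I -> H -> R) : \bar R :=
  ereal_inf [set 'E_D[fun i => (`|grad dot (fi i) xs| ^+ 2)%R]%E |
             xs in argmin (expected_fun D fi)].

Fixpoint sgd (dot : {dot H for idfun}) (fi : I -> H -> R) (gamma : R) (x0 : H)
    (Om : Type) (idx : nat -> Om -> I) (t : nat) (w : Om) : H :=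
  if t is t'.+1 then
    sgd dot fi gamma x0 idx t' w
    - gamma *: grad dot (fi (idx t' w)) (sgd dot fi gamma x0 idx t' w)
  else x0.

Definition average (Om : Type) (x : nat -> Om -> H) (T : nat) (w : Om) : H :=
  T%:R^-1 *: \sum_(0 <= t < T) x t w.

End SGD.

(* Main.v *)
Require Import Defs.
From HB Require Import structures.
From mathcomp Require Import all_boot all_order all_algebra.
From mathcomp Require Import finmap ring lra.
From mathcomp Require Import all_classical all_reals all_analysis measurable_realfun.

Set Implicit Arguments.
Unset Strict Implicit.
Unset Printing Implicit Defensive.

Import Order.TTheory GRing.Theory Num.Theory.
Import numFieldNormedType.Exports.

Local Open Scope classical_set_scope.
Local Open Scope ring_scope.

(** Why the bound holds. Fix a minimiser [xs] of [f] and an index [i]; write [a]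
and [b] for the gradients of [f_i] at [x] and at [xs]. A convex [L]-smooth
function lies above its tangents by at least [|a - b|^2 / (2 L)]
([smooth_convex_cocoercive]). With [gamma L = 1], cocoercivity from [x] to [xs]
turns [|x - gamma a - xs|^2] into
[|x - xs|^2 - 2 gamma (f_i x - f_i xs) + gamma^2 (|a|^2 - |a - b|^2)]: the
quadratic term [|a|^2] is absorbed up to a cross term between [a - b] and [b].
Young's inequality bounds that cross term by [eps |a - b|^2 + |b|^2 / eps], and
cocoercivity from [xs] to [x] pays for [eps |a - b|^2] with a fraction [eps] of
the decrease of [f_i]. This is [sgd_step_le], where the only other surviving term
is a multiple of [<b, x - xs>]. Averaging over [i] kills it, since the mean of
[b] is the gradient of [f] at [xs], which is zero, and [|b|^2] becomes the
gradient variance at [xs]. That variance does not depend on the chosen minimiser: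
the tangent gap between two minimisers has mean zero and dominates the squared
distance of the gradients, so these agree almost surely ([gradient_varianceE]).
Hence [expected_sgd_step_le] for a fixed [x]; integrated over the randomness of
[x_t] and summed over [t] it telescopes to the second inequality. The first one
is Jensen's inequality for [f], which lies above its tangents
([expected_fun_ge_tangent]).

The passage from a fixed [x] to the random iterate requires the independence of
[x_t] and [i_t] and a Tonelli argument, in a space [H] that need not be separable
and carries no sigma-algebra. Bochner integrability gives, for each fixed [x],
that [i |-> grad f_i x] coincides off a null set depending on [x] with a strongly
measurable function. A strongly measurable function takes its values in the
closure of a countable set, and gradients are continuous, so along a strongly
measurable [x_t] only countably many of these null sets matter
([gradient_along_strongly_measurable]). By induction [x_t] is almost surely equal
to a function on the sample space that is strongly measurable for the
sigma-algebra of [i_0, ..., i_{t-1}] ([sgd_strongly_measurable]). Independence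
then says that the joint law of this history and of [i_t] is a product measure
([history_independent], [integral_independent]). The functions of [x_t] that are
integrated may fail to be measurable, because the null sets above may have
non-measurable subsets; but the integral of a nonnegative function is a supremum
over simple functions, which is monotone and insensitive to null sets for
arbitrary functions ([ae_le_ge0_integral]). *)

(** * Hilbert spaces *)

Section Hilbert.
Context {R : realType} {H : completeNormedModType R} (dot : {dot H for idfun}).
Hypothesis hilbertH : hilbert_dot dot.
Implicit Types (x y z u v h : H) (a : R).

Lemma dotC x y : dot x y = dot y x.
Proof. by rewrite hermC expr0 mul1r. Qed.

Lemma dotDl x y z : dot (x + y) z = dot x z + dot y z.
Proof. by rewrite linearDl. Qed.

Lemma dotDr x y z : dot z (x + y) = dot z x + dot z y.
Proof. by rewrite linearDr. Qed.

Lemma dotZl a x y : dot (a *: x) y = a * dot x y.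
Proof. by rewrite linearZl. Qed.

Lemma dotZr a x y : dot y (a *: x) = a * dot y x.
Proof. by rewrite linearZr. Qed.

Lemma dotNl x y : dot (- x) y = - dot x y.
Proof. by rewrite linearNl. Qed.

Lemma dotNr x y : dot y (- x) = - dot y x.
Proof. by rewrite linearNr. Qed.

Definition dotE := (dotDl, dotDr, dotZl, dotZr, dotNl, dotNr).

Lemma normD_sqr x y : `|x + y| ^+ 2 = `|x| ^+ 2 + 2 * dot x y + `|y| ^+ 2.
Proof. by rewrite !hilbertH !dotE (dotC y x); ring. Qed.

Lemma dot_cauchy_schwarz x y : `|dot x y| <= `|x| * `|y|.
Proof.
wlog dxy : x / 0 <= dot x y => [wl|].
  have [|dxy] := leP 0 (dot x y); first exact: wl.
  by rewrite -[leLHS]normrN -dotNl -(normrN x); apply: wl; rewrite dotNl oppr_ge0 ltW.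
rewrite ger0_norm//.
have [->|x0] := eqVneq x 0; first by rewrite linear0l normr0 mul0r.
have [->|y0] := eqVneq y 0; first by rewrite linear0r normr0 mulr0.
have xy0 : 0 < `|x| * `|y| by rewrite mulr_gt0 ?normr_gt0.
have := sqr_ge0 `| `|y| *: x - `|x| *: y|.
rewrite normD_sqr normrN dotNr !dotE !normrZ !normr_id => h.
have : 0 <= (`|x| * `|y|) * (`|x| * `|y| - dot x y) by nra.
by rewrite pmulr_rge0// subr_ge0.
Qed.

(** Young's inequality in the form that splits the gradient at the current point
into its deviation from the gradient at a minimiser and the latter. *)
Lemma normD_sqr_le x y (e : R) : 0 < e ->
  `|x + y| ^+ 2 <= (1 + e) * `|x| ^+ 2 + (1 + e^-1) * `|y| ^+ 2.
Proof.
move=> e0; rewrite normD_sqr.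
have := dot_cauchy_schwarz x y; rewrite ler_norml => /andP[_].
have : 0 <= e^-1 * (e * `|x| - `|y|) ^+ 2 by rewrite mulr_ge0 ?sqr_ge0 ?invr_ge0 ?ltW.
have ee : e^-1 * e = 1 by rewrite mulVf ?gt_eqF.
move: (`|x|) (`|y|) (dot x y) => p q d.
have -> : e^-1 * (e * p - q) ^+ 2
  = e^-1 * e * (e * p ^+ 2) - 2 * (e^-1 * e) * (p * q) + e^-1 * q ^+ 2 by ring.
rewrite ee => h1 h2; lra.
Qed.

(** The representing vector minimises [|v|^2 - 2 phi v]: by the parallelogram law
every minimising sequence is Cauchy, and completeness provides the minimiser. *)
Lemma riesz_representation (phi : {linear H -> R^o}) :
  continuous (phi : H -> R^o) -> exists v, forall h, phi h = dot v h.
Proof.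
move=> cphi.
have [M [M0 phiM]] : exists M, 0 < M /\ forall h, `|phi h| <= M * `|h|.
  have /linear_boundedP := continuous_linear_bounded 0 (cphi 0).
  by case/pinfty_ex_gt0 => M M0 hM; exists M.
pose J v := `|v| ^+ 2 - 2 * (phi v : R).
have J_lb v : - M ^+ 2 <= J v.
  have := phiM v; rewrite ler_norml => /andP[_ h].
  have := sqr_ge0 (`|v| - M); rewrite /J; nra.
have has_infJ : has_inf (range J).
  by split; [exists (J 0), 0|exists (- M ^+ 2) => _ [v _ <-]].
have J_inf v : inf (range J) <= J v.
  by apply: ge_inf; [exact: has_infJ.2|exists v].
have /choice[u uP] n : exists v, J v < inf (range J) + n.+1%:R^-1.
  have n0 : 0 < n.+1%:R^-1 :> R by rewrite invr_gt0.
  by have [_ [v _ <-] hv] := inf_adherent n0 has_infJ; exists v.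
have u_dist n k : `|u n - u k| ^+ 2 <= 2 * (n.+1%:R^-1 + k.+1%:R^-1).
  have := J_inf (2^-1 *: (u n + u k)); have := uP n; have := uP k.
  have -> : J (2^-1 *: (u n + u k)) = `|2^-1 *: (u n + u k)| ^+ 2
      - 2 * (2^-1 * ((phi (u n) : R) + (phi (u k) : R))).
    by rewrite /J [phi (_ *: _)]linearZ [phi (_ + _)]linearD.
  rewrite /J !normrZ exprMn !normD_sqr normrN dotNr.
  rewrite (@ger0_norm _ 2^-1) ?invr_ge0// /GRing.scale /=.
  move: (u n) (u k) n.+1%:R^-1 k.+1%:R^-1 (phi _) (phi _) => a b c d e g; set i := inf _.
  lra.
have u_cvg : cvg (u @ \oo).
  apply: cauchy_cvg; apply: cauchy_exP => e e0.
  have : (4 * n.+1%:R^-1 : R) @[n --> \oo] --> (4 * 0 : R).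
    by apply: cvgM; [exact: cvg_cst|exact: cvg_harmonic].
  rewrite mulr0 => /cvgrPdist_lt /(_ (e ^+ 2)) => /(_ ltac:(exact: exprn_gt0)) [N _ NP].
  exists (u N); exists N => // n /= Nn; rewrite -ball_normE /=.
  have := NP N (leqnn N); rewrite sub0r normrN ger0_norm; last by rewrite mulr_ge0.
  move=> Ne.
  rewrite -(@ltr_pXn2r _ 2) ?nnegrE ?(ltW e0)//.
  apply: (le_lt_trans _ Ne); apply: (le_trans (u_dist _ _)).
  have : n.+1%:R^-1 <= N.+1%:R^-1 :> R by rewrite lef_pV2 ?posrE// ler_nat.
  by move: n.+1%:R^-1 N.+1%:R^-1 => a b; lra.
pose v := lim (u @ \oo).
have Jv : J v <= inf (range J).
  have cJ : J (u n) @[n --> \oo] --> J v.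
    apply: cvgB; first by rewrite expr2; apply: cvgM; exact: cvg_norm.
    apply: cvgM; first exact: cvg_cst.
    by apply: (cvg_comp _ _ u_cvg); exact: cphi.
  have ch : (inf (range J) + n.+1%:R^-1 : R) @[n --> \oo] --> inf (range J) + 0.
    by apply: cvgD; [exact: cvg_cst|exact: cvg_harmonic].
  rewrite -[leRHS]addr0; apply: (ler_cvg_to cJ ch).
  by near=> n; exact: ltW.
exists v => h.
(* first-order optimality at v of the quadratic J along the line v + t h *)
have opt t : 0 <= t ^+ 2 * `|h| ^+ 2 + 2 * t * (dot v h - phi h).
  have := le_trans Jv (J_inf (v + t *: h)).
  have -> : J (v + t *: h) = `|v + t *: h| ^+ 2 - 2 * ((phi v : R) + t * (phi h : R)).
    by rewrite /J [phi (_ + _)]linearD [phi (_ *: _)]linearZ.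
  rewrite /J normD_sqr normrZ exprMn real_normK ?num_real// dotZr.
  by move: (phi v) (phi h) => a b; nra.
set c := dot v h - phi h in opt.
suff /eqP : c = 0 by rewrite subr_eq0 => /eqP.
have [h0|h0] := eqVneq (`|h| ^+ 2) 0.
  by have := opt (- c); rewrite h0; nra.
have hn : `|h| != 0 by rewrite -sqrf_eq0.
have h1 : 0 < `|h| ^+ 2 by rewrite lt0r h0 sqr_ge0.
have := opt (- c / `|h| ^+ 2).
have -> : (- c / `|h| ^+ 2) ^+ 2 * `|h| ^+ 2 + 2 * (- c / `|h| ^+ 2) * c
  = - (c ^+ 2 / `|h| ^+ 2) by field.
rewrite oppr_ge0 pmulr_lle0 ?invr_gt0// => c2.
by apply/eqP; rewrite -sqrf_eq0 eq_le c2 sqr_ge0.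
Unshelve. all: by end_near.
Qed.

(** By Riesz representation the set of candidates in the definition of [grad] is
nonempty, so its default value never occurs. *)
Lemma gradE (f : H -> R) x h : differentiable f x ->
  'd f x h = dot (grad dot f x) h.
Proof.
move=> df.
have [v hv] := @riesz_representation ('d (f : H -> R^o) x) (diff_continuous df).
by rewrite /grad; case: xgetP => [_ -> //|/(_ v)].
Qed.

End Hilbert.

(** * Convex smooth functions *)

Section Smooth.
Context {R : realType} {H : completeNormedModType R} (dot : {dot H for idfun}).
Hypothesis hilbertH : hilbert_dot dot.
Implicit Types (x y z u v h : H) (a : R).

Lemma is_derive_line (f : H -> R) x h (t : R) :
  (forall z, differentiable f z) ->
  is_derive t 1 (fun s => f (x + s *: h)) (dot (grad dot f (x + t *: h)) h).
Proof.
move=> df; have dfz := @diff_derivable _ _ _ f (x + t *: h) h (df _).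
have E : (fun s : R => s^-1 *: (((fun s => f (x + s *: h)) \o shift t) (s *: 1)
        - f (x + t *: h)))
    = (fun s => s^-1 *: ((f \o shift (x + t *: h)) (s *: h) - f (x + t *: h))).
  apply/funext => s /=; congr (_ *: (f _ - _)).
  by rewrite -[s *: 1]/(s * 1) mulr1 scalerDl addrCA.
split; first by rewrite /derivable E.
by rewrite -gradE// -deriveE// /derive E.
Qed.

(** The difference quotients of [f] from [x] towards [y] are at most [f y - f x] by
convexity, and the directional derivative is their limit from the right. *)
Lemma convex_ge_tangent (f : H -> R) x y :
  (forall z, differentiable f z) -> convex_function setT f ->
  f x + dot (grad dot f x) (y - x) <= f y.
Proof.
move=> df cf; have [dl dE] := @is_derive_line f x (y - x) 0 df.
move: dE; rewrite scale0r addr0 => <-.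
rewrite addrC -lerBrDr.
rewrite /derive cvg_at_rightE//.
apply: limr_le; first by apply: cvgP (cvg_dnbhs_at_right _); exact: dl.
near=> s.
have s0 : 0 < s by near: s; exact: nbhs_right_gt.
have s1 : s <= 1 by near: s; exact: nbhs_right_le.
rewrite /= scale0r !addr0 -[s *: 1]/(s * 1) mulr1 -[_ *: _]/(_ * _).
rewrite mulrC ler_pdivrMr//.
have := cf (Itv01 (ltW s0) s1) y x (mem_set I) (mem_set I).
rewrite -[leRHS]/(s * f y + (1 - s) * f x) -[leLHS]/(f (s *: y + (1 - s) *: x)).
have -> : s *: y + (1 - s) *: x = x + s *: (y - x).
  by rewrite scalerBl scale1r scalerBr addrCA addrA addrC addrA.
lra.
Unshelve. all: by end_near.
Qed.

(** Along the segment from [x] to [y] the difference between [f] and the quadratic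
model has derivative at most zero, by Cauchy-Schwarz and the Lipschitz bound. *)
Lemma smooth_le_quadratic (f : H -> R) (L : R) x y : smooth dot L f ->
  f y <= f x + dot (grad dot f x) (y - x) + L / 2 * `|y - x| ^+ 2.
Proof.
move=> [df Lf].
pose g s := f (x + s *: (y - x)).
pose c := dot (grad dot f x) (y - x).
pose k s := g s - s * c - s ^+ 2 * (L / 2 * `|y - x| ^+ 2).
pose dk s := dot (grad dot f (x + s *: (y - x))) (y - x) - c
   - s * (L * `|y - x| ^+ 2).
have kd (s : R) : is_derive s 1 k (dk s).
  have := @is_derive_line f x (y - x) s df.
  rewrite -/g => dg.
  apply: is_derive_eq.
  rewrite /dk; move: (dot _ (y - x)) (`|_| ^+ 2) => D q.
  by rewrite !scaler0 /GRing.scale /=; field.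
have ck : {within `[0, 1], continuous k}.
  apply: continuous_subspaceT => s; have ? := kd s.
  by apply: differentiable_continuous; apply/derivable1_diffP; apply: ex_derive.
have [s s01 kE] := MVT ltr01 (fun s _ => kd s) ck.
have s0 : 0 <= s by move: s01; rewrite in_itv /= => /andP[/ltW].
have : dk s <= 0.
  rewrite /dk /c -dotNl -dotDl.
  have := Lf (x + s *: (y - x), x) (conj I I) => /=.
  have -> : x + s *: (y - x) - x = s *: (y - x) by rewrite addrAC subrr add0r.
  rewrite normrZ ger0_norm// => LD.
  rewrite subr_le0; apply: (le_trans (ler_norm _)).
  apply: (le_trans (dot_cauchy_schwarz hilbertH _ _)).
  apply: (le_trans (ler_wpM2r (normr_ge0 _) LD)).
  by rewrite expr2 !mulrA (mulrC s).
move: kE; rewrite /k /g !scale1r !scale0r addr0 addrCA subrr addr0.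
rewrite /c; move: (dot _ (y - x)) (`|_| ^+ 2) => D q; lra.
Qed.

(** Follow the tangent of [f] at [x] up to the point where the quadratic upper
model of [f] at [y] is least relative to that tangent. *)
Lemma smooth_convex_cocoercive (f : H -> R) (L : R) x y : 0 < L ->
  convex_function setT f -> smooth dot L f ->
  f x + dot (grad dot f x) (y - x)
    + (2 * L)^-1 * `|grad dot f y - grad dot f x| ^+ 2 <= f y.
Proof.
move=> L0 cf sf; have df := sf.1.
(* z is the minimiser of the quadratic upper model of f - <grad f x, .> at y *)
pose z := y - L^-1 *: (grad dot f y - grad dot f x).
have h1 := @convex_ge_tangent f x z df cf.
have h2 := @smooth_le_quadratic f L y z sf.
move: h1 h2; rewrite {}/z.
move: (grad dot f x) (grad dot f y) (f x) (f y) (f _) => a b F G K.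
rewrite (addrAC y _ (- y)) subrr add0r (addrAC y _ (- x)).
move: (y - x) => e h1 h2.
have {}h1 := le_trans h1 h2.
have Ln : L != 0 by rewrite gt_eqF.
have Ll : L * L^-1 = 1 by rewrite divff.
have E : L / 2 * `|- (L^-1 *: (b - a))| ^+ 2 = L^-1 / 2 * `|b - a| ^+ 2.
  rewrite normrN normrZ exprMn real_normK ?num_real//.
  transitivity (L * L^-1 * (L^-1 / 2 * `|b - a| ^+ 2)); first by field.
  by rewrite Ll mul1r.
move: h1; rewrite E dotDr !dotNr !dotZr => h1.
have : `|b - a| ^+ 2 = dot b (b - a) - dot a (b - a).
  by rewrite hilbertH -dotNl -dotDl.
rewrite invfM; move: L^-1 h1 => l.
move: (`|_| ^+ 2) (dot b _) (dot a (b - a)) (dot a e) => q db da ae h1 h3.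
rewrite h3 in h1 *; lra.
Qed.

(** The algebra of one step: here [d] stands for [x - xs], [a] and [b] for the
gradients at [x] and [xs], [F] and [Fs] for the values there. The two hypotheses
are the two directions of cocoercivity with [L = gamma^-1]; the first is used
with weight [2 gamma], the second with weight [2 gamma eps]. *)
Lemma sgd_step_algebra (d a b : H) (F Fs gamma eps : R) :
  0 < gamma -> 0 < eps ->
  F - dot a d + gamma / 2 * `|a - b| ^+ 2 <= Fs ->
  Fs + dot b d + gamma / 2 * `|a - b| ^+ 2 <= F ->
  `|d - gamma *: a| ^+ 2 <=
  `|d| ^+ 2 + gamma ^+ 2 * (1 + eps^-1) * `|b| ^+ 2
  - 2 * gamma * (1 - eps) * (F - Fs) - 2 * gamma * eps * dot b d.
Proof.
move=> g0 e0 h1 h2.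
have := normD_sqr_le hilbertH (a - b) b e0; rewrite subrK => young.
have -> : `|d - gamma *: a| ^+ 2
    = `|d| ^+ 2 - 2 * gamma * dot a d + gamma ^+ 2 * `|a| ^+ 2.
  rewrite (normD_sqr hilbertH) normrN normrZ exprMn real_normK ?num_real//.
  by rewrite dotNr dotZr (dotC dot d); ring.
move: h1 h2 young.
move: (`|d| ^+ 2) (`|a| ^+ 2) (`|b| ^+ 2) (`|a - b| ^+ 2) (dot a d) (dot b d) eps^-1.
move=> D A B AB ad bd i h1 h2 young.
have g1 := ler_wpM2l (ltW g0) h1.
have g2 := ler_wpM2l (ltW (mulr_gt0 g0 e0)) h2.
have g3 := ler_wpM2l (ltW (mulr_gt0 g0 g0)) young.
lra.
Qed.

Lemma sgd_step_le (f : H -> R) (L gamma eps : R) x xs : 0 < L -> 0 < gamma ->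
  gamma * L = 1 -> 0 < eps -> convex_function setT f -> smooth dot L f ->
  `|x - gamma *: grad dot f x - xs| ^+ 2 <=
  `|x - xs| ^+ 2 + gamma ^+ 2 * (1 + eps^-1) * `|grad dot f xs| ^+ 2
  - 2 * gamma * (1 - eps) * (f x - f xs)
  - 2 * gamma * eps * dot (grad dot f xs) (x - xs).
Proof.
move=> L0 g0 gL e0 cf sf.
have h1 := smooth_convex_cocoercive x xs L0 cf sf.
have h2 := smooth_convex_cocoercive xs x L0 cf sf.
have El : (2 * L)^-1 = gamma / 2.
  by rewrite -(mulr1_eq gL) invfM invrK mulrC.
move: h1 h2; rewrite {}El.
move: (grad dot f x) (grad dot f xs) (f x) (f xs) => a b F Fs.
rewrite (distrC b a) => h1 h2.
rewrite addrAC; apply: sgd_step_algebra => //.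
by rewrite -dotNr opprB.
Qed.

End Smooth.

(** * Integrals of possibly non-measurable functions *)

Section LowerIntegral.
Context {d : measure_display} {T : measurableType d} {R : realType}.
Variable mu : {measure set T -> \bar R}.
Import HBNNSimple.

(** The integral of an arbitrary nonnegative function is the supremum of those of
the simple functions below it. A simple function below [f], once set to zero on
the exceptional null set, is below [g] and has kept its integral. *)
Lemma ae_le_ge0_integral (f g : T -> \bar R) :
  (forall z, 0 <= f z)%E -> (forall z, 0 <= g z)%E ->
  {ae mu, forall z, (f z <= g z)%E} ->
  (\int[mu]_z f z <= \int[mu]_z g z)%E.
Proof.
move=> f0 g0 [N [mN N0 fgN]].
have fg z : (~` N) z -> (f z <= g z)%E.
  by move=> Nz; apply: contrapT => fgz; exact/Nz/fgN.
rewrite !ge0_integralTE//.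
apply: ge_ereal_sup => _ /= [h hf <-].
pose h' := proj_nnsfun h (measurableC mN).
rewrite -integralT_nnsfun (_ : (\int[mu]_z (h z)%:E = \int[mu]_z (h' z)%:E)%E).
  rewrite integralT_nnsfun; apply: ereal_sup_ubound; exists h' => //= z.
  rewrite -[leLHS]/((h z * \1_(~` N) z)%:E) indicE; have [/set_mem Nz|_] := boolP (z \in ~` N).
    by rewrite mulr1 (le_trans (hf z))// fg.
  by rewrite mulr0.
apply: ae_eq_integral => //.
- exact/measurable_EFinP.
- exact/measurable_EFinP.
- exists N; split => // z /= /not_implyP[_ hz]; apply: contrapT => zN; apply: hz.
  by rewrite -[RHS]/((h z * \1_(~` N) z)%:E) indicE mem_set// mulr1.
Qed.

Lemma ae_eq_ge0_integral (f g : T -> \bar R) :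
  (forall z, 0 <= f z)%E -> (forall z, 0 <= g z)%E ->
  {ae mu, forall z, f z = g z} ->
  (\int[mu]_z f z = \int[mu]_z g z)%E.
Proof.
move=> f0 g0 fg; apply/eqP; rewrite eq_le; apply/andP; split;
  apply: ae_le_ge0_integral => //; by apply: filterS fg => z ->.
Qed.

End LowerIntegral.

(** * Strongly measurable functions *)

Section StronglyMeasurable.
Context {d : measure_display} {T : measurableType d} {R : realType}.

(** Pointwise limits of simple functions, in the form given by Pettis: the values
lie in a separable set and distances to fixed points are measurable. The
separating sequence [c] is a parameter because properties of a random function
that are known only at each point, up to a null set, have to be collected along
it. *)
Definition strongly_measurable_to {V : normedModType R} (c : nat -> V) (g : T -> V) :=
  (forall v, measurable_fun setT (fun z => `|g z - v|)) /\
  (forall z, closure (range c) (g z)).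

Definition strongly_measurable {V : normedModType R} (g : T -> V) :=
  exists c, strongly_measurable_to c g.

Lemma measurable_ge (h : T -> R) r : measurable_fun setT h ->
  measurable [set z | r <= h z].
Proof.
move=> mh; have := mh measurableT `[r, +oo[%classic (measurable_itv _).
rewrite setTI (_ : _ @^-1` _ = [set z | r <= h z])//.
by apply/seteqP; split => z /=; rewrite in_itv /= andbT.
Qed.

Lemma measurable_fun_gt (h : T -> R) :
  (forall a, measurable [set z | a < h z]) -> measurable_fun setT h.
Proof.
move=> mh mT; apply: (measurability _ (RGenOInfty.measurableE R)) => //.
move=> _ [_ [a ->] <-]; rewrite setTI (_ : _ @^-1` _ = [set z | a < h z])//.
by apply/seteqP; split => z /=; rewrite in_itv /= andbT.
Qed.

(** [phi (g z) z > a] means that for some [m] and [n] every [c k] closer to [g z]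
than [1/n] satisfies [phi (c k) z >= a + 1/m]: continuity in the first variable
gives one direction, density of [c] near [g z] the other. The condition only
involves [phi] at the points [c k]. *)
Lemma measurable_caratheodory {V : normedModType R} (c : nat -> V) (g : T -> V)
    (phi : V -> T -> R) :
  strongly_measurable_to c g ->
  (forall z, continuous (phi ^~ z)) ->
  (forall k, measurable_fun setT (phi (c k))) ->
  measurable_fun setT (fun z => phi (g z) z).
Proof.
move=> [mg cg] cphi mphi; apply: measurable_fun_gt => a.
rewrite (_ : [set z | _] = \bigcup_m \bigcup_n \bigcap_k
   ([set z | n.+1%:R^-1 <= `|g z - c k|] `|` [set z | a + m.+1%:R^-1 <= phi (c k) z])).
  apply: bigcupT_measurable => m; apply: bigcupT_measurable => n.
  apply: bigcapT_measurable => k; apply: measurableU; exact: measurable_ge.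
apply/seteqP; split => z /=.
  rewrite -subr_gt0 => az.
  have [m am] : exists m, m.+1%:R^-1 < phi (g z) z - a.
    by have [m _ /(_ m (leqnn m))] := near_infty_natSinv_lt (PosNum az); exists m.
  have : \forall u \near g z, a + m.+1%:R^-1 < phi u z.
    by apply: (cvgr_gt (phi (g z) z)); [exact: cphi|rewrite addrC -ltrBrDr].
  move=> /nbhs_normP[e /= e0 he].
  have [n ne] : exists n, n.+1%:R^-1 < e.
    by have [n _ /(_ n (leqnn n))] := near_infty_natSinv_lt (PosNum e0); exists n.
  exists m => //; exists n => // k _ /=.
  have [ck|ck] := leP n.+1%:R^-1 `|g z - c k|; [by left|right].
  by apply/ltW/he => /=; exact: lt_trans ne.
move=> [m _ [n _ mn]]; rewrite ltNge; apply/negP => az.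
have m0 : 0 < m.+1%:R^-1 :> R by rewrite invr_gt0.
have n0 : 0 < n.+1%:R^-1 :> R by rewrite invr_gt0.
have h1 : \forall u \near g z, phi u z < a + m.+1%:R^-1.
  by apply: (cvgr_lt (phi (g z) z)); [exact: cphi|rewrite (le_lt_trans az)// ltrDl].
have h2 : \forall u \near g z, `|g z - u| < n.+1%:R^-1.
  by apply/nbhs_normP; exists n.+1%:R^-1.
have [_ /= [[k _ <-] [k1 k2]]] := cg z _ (filterI h1 h2).
by case: (mn k I) => /=; rewrite leNgt ?k1 ?k2.
Qed.

(** The distances to fixed points are measurable by [measurable_caratheodory]; the
sequences separating the values of the [Phi (c k)], indexed by pairs, jointly
separate those of the composite. *)
Lemma strongly_measurable_caratheodory {V W : normedModType R} (c : nat -> V)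
    (g : T -> V) (Phi : V -> T -> W) :
  strongly_measurable_to c g ->
  (forall z, continuous (Phi ^~ z)) ->
  (forall k, strongly_measurable (Phi (c k))) ->
  strongly_measurable (fun z => Phi (g z) z).
Proof.
move=> gc cPhi /choice[e eP].
exists (fun n => if choice.unpickle n is Some (k, l) then e k l else 0); split.
  move=> w; apply: (measurable_caratheodory (phi := fun u z => `|Phi u z - w|) gc).
    move=> z u; apply: (cvg_norm (f := fun u => Phi u z - w)).
    by apply: cvgB; [exact: cPhi|exact: cvg_cst].
  by move=> k; exact: (eP k).1.
move=> z B /nbhs_interior BPhi.
have [_ [[k _ <-] /= kB]] := gc.2 z _ (cPhi z (g z) _ BPhi).
have [_ [[l _ <-] lB]] := (eP k).2 z _ kB.
by exists (e k l); split => //; exists (choice.pickle (k, l)) => //; rewrite choice.pickleK.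
Qed.

Lemma strongly_measurable_cst {V : normedModType R} (v : V) :
  strongly_measurable (fun _ => v).
Proof.
exists (fun _ => v); split => [w|_]; first exact: measurable_cst.
by apply: subset_closure; exists 0%N.
Qed.

Lemma strongly_measurable_subZ {V : normedModType R} (a : R) (g h : T -> V) :
  strongly_measurable g -> strongly_measurable h ->
  strongly_measurable (fun z => g z - a *: h z).
Proof.
move=> [c gc] [c' hc].
apply: (strongly_measurable_caratheodory (Phi := fun u z => u - a *: h z) gc).
  by move=> z u; apply: cvgB; [exact: cvg_id|exact: cvg_cst].
move=> k.
apply: (strongly_measurable_caratheodory (Phi := fun u z => c k - a *: u) hc).
  move=> z u; apply: cvgB; first exact: cvg_cst.
  by apply: cvgZ; [exact: cvg_cst|exact: cvg_id].
by move=> l; exact: strongly_measurable_cst.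
Qed.

Lemma measurable_strongly_measurable {V : normedModType R} (g : T -> V) (phi : V -> R) :
  strongly_measurable g -> continuous phi -> measurable_fun setT (fun z => phi (g z)).
Proof.
move=> [c gc] cphi.
by apply: (measurable_caratheodory (phi := fun u _ => phi u) gc) => // z.
Qed.

End StronglyMeasurable.

Lemma strongly_measurable_to_comp {d d' : measure_display} {T : measurableType d}
    {T' : measurableType d'} {R : realType} {V : normedModType R} (c : nat -> V)
    (g : T -> V) (p : T' -> T) :
  strongly_measurable_to c g -> measurable_fun setT p ->
  strongly_measurable_to c (g \o p).
Proof.
move=> [mg cg] mp; split => [v|z]; last exact: cg.
exact: (measurableT_comp (mg v) mp).
Qed.

Lemma strongly_measurable_comp {d d' : measure_display} {T : measurableType d}
    {T' : measurableType d'} {R : realType} {V : normedModType R}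
    (g : T -> V) (p : T' -> T) :
  strongly_measurable g -> measurable_fun setT p ->
  strongly_measurable (g \o p).
Proof. by move=> [c gc] mp; exists c; exact: strongly_measurable_to_comp. Qed.

Lemma countable_sub_range {V : pointedType} (C : set V) :
  countable C -> exists c : nat -> V, C `<=` range c.
Proof.
move=> /countable_injP[h hinj].
exists (fun n => get [set v | C v /\ h v = n]) => v Cv; exists (h v) => //.
case: xgetP => [w _ [Cw hw]|/(_ v)/=]; last by case.
by apply: hinj => //; exact: mem_set.
Qed.

(** * Bochner expectations *)

Section Bochner.
Context {d : measure_display} {T : measurableType d} {R : realType}.

Lemma vsimple_measurable {V : normedModType R} (s : T -> V) (phi : V -> R) :
  vsimple s -> measurable_fun setT (phi \o s).
Proof.
move=> [fs ms] _ B _; rewrite setTI.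
rewrite (_ : _ @^-1` _ = \bigcup_(v in range s `&` phi @^-1` B) (s @^-1` [set v])).
  by apply: fin_bigcup_measurable => //; exact: finite_setIl.
apply/seteqP; split => [z /= Bz|z /= [v /= [_ Bv] sv]]; last by rewrite sv.
by exists (s z).
Qed.

Lemma vsimple_off {V : normedModType R} (N : set T) (s : T -> V) :
  measurable N -> vsimple s -> vsimple (fun z => if z \in N then 0 else s z).
Proof.
move=> mN [fs ms]; split.
  apply: (@sub_finite_set _ _ (range s `|` [set 0])).
    by move=> _ [z _ <-]; case: ifP => _; [right|left; exists z].
  by rewrite finite_setU; split.
move=> v; rewrite (_ : _ @^-1` _ =
    (if v == 0 then N else set0) `|` (s @^-1` [set v] `\` N)).
  apply: measurableU; first by case: ifP.
  exact: measurableD.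
apply/seteqP; split => z /=.
  have [/set_mem Nz <-|/negP nz <-] := boolP (z \in N); first by rewrite eqxx; left.
  by right; split=> // Nz; apply: nz; exact: mem_set.
case=> [|[<- Nz]]; last by rewrite memNset.
by case: eqP => // -> Nz; rewrite mem_set.
Qed.

(** The values of all the approximating simple functions form the countable set
whose closure contains the values of the limit. *)
Lemma cvg_vsimple_strongly_measurable {V : normedModType R} (s : nat -> T -> V)
    (g : T -> V) :
  (forall n, vsimple (s n)) -> (forall z, s n z @[n --> \oo] --> g z) ->
  strongly_measurable g.
Proof.
move=> ss sg.
have [c cP] : exists c : nat -> V, \bigcup_n range (s n) `<=` range c.
  apply: countable_sub_range; apply: bigcup_countable => // n _.
  exact: finite_set_countable (ss n).1.
exists c; split => [v|z].
  apply: (@measurable_fun_cvg _ _ _ _ (fun n z => `|s n z - v|)) => [n|z _].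
    exact: (vsimple_measurable (fun u => `|u - v|) (ss n)).
  by apply: cvg_norm; apply: cvgB; [exact: sg|exact: cvg_cst].
move=> B /sg[n _ nB]; exists (s n z); split; last exact: (nB n (leqnn n)).
by apply: cP; exists n.
Qed.

Lemma strongly_measurable_off {V : normedModType R} (N : set T) (g : T -> V) :
  measurable N -> strongly_measurable g ->
  strongly_measurable (fun z => if z \in N then 0 else g z).
Proof.
move=> mN [c gc].
have cE b : continuous (fun u : V => if b then 0 else u).
  by case: b => u; [exact: cvg_cst|exact: cvg_id].
apply: (strongly_measurable_caratheodory
  (Phi := fun u z => if z \in N then 0 else u) gc) => [z|k].
  exact: cE.
apply: (@cvg_vsimple_strongly_measurable _
  (fun _ z => if z \in N then 0 else c k)) => [_|z]; last exact: cvg_cst.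
apply: vsimple_off => //; split.
  by apply: (@sub_finite_set _ _ [set c k]) => // _ [z _ <-].
by move=> v; rewrite (preimage_cst (c k)); case: ifP.
Qed.

Variable P : probability T R.

Lemma bochner_strongly_measurable {V : normedModType R} (g : T -> V) (m : V) :
  bochner_expectation P g m -> exists N, [/\ measurable N, P N = 0%E &
    strongly_measurable (fun z => if z \in N then 0 else g z)].
Proof.
move=> [s [ss [N [mN N0 Ng]] _ _]]; exists N; split => //.
apply: (@cvg_vsimple_strongly_measurable _
   (fun n z => if z \in N then 0 else s n z)) => [n|z].
  exact: vsimple_off.
case: ifPn => [_|/negP nz]; first exact: cvg_cst.
by apply: contrapT => h; apply: nz; apply: mem_set; exact: Ng.
Qed.

Context {H : completeNormedModType R} (dot : {dot H for idfun}).
Hypothesis hilbertH : hilbert_dot dot.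

Lemma dot_continuous h : continuous (fun u => dot u h).
Proof.
move=> u; apply/cvgrPdist_le => e e0.
near=> v.
rewrite -dotNl -dotDl (le_trans (dot_cauchy_schwarz hilbertH _ _))//.
have h1 : 0 < `|h| + 1 by rewrite ltr_wpDl.
rewrite (@le_trans _ _ (`|u - v| * (`|h| + 1)))//.
  by rewrite ler_wpM2l// lerDl.
rewrite -ler_pdivlMr//; near: v.
by apply: cvgr_dist_le; [exact: cvg_id|rewrite divr_gt0].
Unshelve. all: by end_near.
Qed.

(** The index of a term is a vector because the sum comes from a simple function
listed by its values. *)
Lemma integral_sum_indic (r : seq H) (a : H -> R) (A : H -> set T) :
  (forall v, measurable (A v)) ->
  P.-integrable setT (EFin \o (fun z => \sum_(v <- r) a v * \1_(A v) z)) /\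
  \int[P]_z (\sum_(v <- r) a v * \1_(A v) z) = \sum_(v <- r) a v * fine (P (A v)).
Proof.
move=> mA; elim: r => [|v r [IHi IHe]].
  rewrite big_nil; split; last by under eq_Rintegral do rewrite big_nil;
    rewrite Rintegral_cst// mul0r.
  by apply: eq_integrable (integrable0 _ _) => //= z _; rewrite /= big_nil.
have iv : P.-integrable setT (EFin \o \1_(A v)) by exact: integrable_indic.
have iav : P.-integrable setT (EFin \o (fun z => a v * \1_(A v) z)).
  by apply: eq_integrable (integrableZl measurableT (a v) iv) => //= z _; rewrite EFinM.
split.
  apply: eq_integrable (integrableD measurableT iav IHi) => //= z _.
  by rewrite /= big_cons EFinD.
under eq_Rintegral do rewrite big_cons.
rewrite RintegralD// IHe big_cons RintegralZl//.
by rewrite /Rintegral integral_indic// setIT.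
Qed.

Lemma vsimple_expectation_dot (s : T -> H) h : vsimple s ->
  P.-integrable setT (EFin \o (fun z => dot (s z) h)) /\
  \int[P]_z dot (s z) h = dot (vsimple_expectation P s) h.
Proof.
move=> ss; have [fs ms] := ss.
have E : (fun z => dot (s z) h) =
    (fun z => \sum_(v <- fset_set (range s)) dot v h * \1_(s @^-1` [set v]) z).
  apply/funext => z.
  rewrite (big_fsetD1 (s z)) /=; last by rewrite in_fset_set// mem_set//; exists z.
  rewrite indicE mem_set// mulr1 big1_fset ?addr0// => v.
  rewrite !inE => /andP[/eqP vz _] _; rewrite indicE memNset ?mulr0//=.
  by move=> /esym.
rewrite E; have [] := @integral_sum_indic (fset_set (range s)) (fun v => dot v h)
  (fun v => s @^-1` [set v]) ms.
move=> -> ->; split=> //.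
rewrite /vsimple_expectation fsbig_finite//=.
elim: (enum_fset _) => [|v r IH]; first by rewrite !big_nil linear0l.
by rewrite !big_cons dotDl dotZl IH mulrC.
Qed.

(** Testing against [h] commutes with the Bochner integral: it does so for simple
functions, and the error made in replacing [g] by its approximations is at most
[|h|] times their distance in mean. The function [g'] is a strongly measurable
version of [g]. *)
Lemma bochner_expectation_dot (g g' : T -> H) (m h : H) (N : set T) :
  bochner_expectation P g m ->
  measurable N -> P N = 0%E -> (forall z, ~ N z -> g' z = g z) ->
  strongly_measurable g' ->
  P.-integrable setT (EFin \o (fun z => dot (g' z) h)) /\
  \int[P]_z dot (g' z) h = dot m h.
Proof.
move=> [s [ss sg sL1 sm]] mN N0 gN mg'.
pose e n := \int[P]_z `|s n z - g' z|.
have eE n : ('E_P[fun w => `|s n w - g w|%R])%E = (\int[P]_z (`|s n z - g' z|)%:E)%E.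
  rewrite expectation.unlock; apply: ae_eq_ge0_integral => //.
  by exists N; split=> // z hz; apply: contrapT => /gN E; apply: hz; rewrite /= E.
have int_s n := vsimple_expectation_dot h (ss n).
have mdiff n : measurable_fun setT (fun z => `|s n z - g' z|).
  have [c gc] := mg'.
  apply: (measurable_caratheodory (phi := fun u z => `|s n z - u|) gc) => [z u|k].
    by apply: (cvg_norm (f := fun u => s n z - u)); apply: cvgB; [exact: cvg_cst|exact: cvg_id].
  exact: (vsimple_measurable (fun u => `|u - c k|) (ss n)).
have [e_fin e0] : (\forall n \near \oo,
    P.-integrable setT (EFin \o (fun z => `|s n z - g' z|))) /\
    (e n @[n --> \oo] --> 0).
  have /fine_cvgP[fin lim0] : (\int[P]_z (`|s n z - g' z|)%:E)%E @[n --> \oo] --> 0%:E.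
    by under eq_fun do rewrite -eE.
  split; last exact: lim0.
  apply: filterS fin => n fin_n; apply/integrableP; split.
    exact/measurable_EFinP.
  under eq_integral do rewrite /= normr_id.
  by rewrite ltey_eq fin_n.
have mdot : measurable_fun setT (fun z => dot (g' z) h).
  exact: (measurable_strongly_measurable mg' (@dot_continuous h)).
have dot_le n z : `|dot (g' z) h - dot (s n z) h| <= `|h| * `|s n z - g' z|.
  rewrite -dotNl -dotDl distrC mulrC; exact: dot_cauchy_schwarz.
have int_sg n : P.-integrable setT (EFin \o (fun z => `|s n z - g' z|)) ->
    P.-integrable setT (EFin \o (fun z => dot (g' z) h - dot (s n z) h)).
  move=> /(integrableZl measurableT `|h|); apply: le_integrable => //.
    apply/measurable_EFinP; apply: measurable_funB => //.
    exact: (vsimple_measurable (fun u => dot u h) (ss n)).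
  by move=> z _ /=; rewrite lee_fin (le_trans (dot_le n z))// ler_norm.
have int_g : P.-integrable setT (EFin \o (fun z => dot (g' z) h)).
  have [n _ /(_ n (leqnn n)) /int_sg isg] := e_fin.
  apply: eq_integrable (integrableD measurableT isg (int_s n).1) => //= z _.
  by rewrite /= -EFinD subrK.
split => //.
have lim1 : dot (vsimple_expectation P (s n)) h @[n --> \oo] --> dot m h.
  exact: (cvg_comp _ _ sm (@dot_continuous h m)).
have lim2 : dot (vsimple_expectation P (s n)) h @[n --> \oo] -->
    \int[P]_z dot (g' z) h.
  have e0h : `|h| * e n @[n --> \oo] --> `|h| * 0.
    by apply: cvgM; [exact: cvg_cst|exact: e0].
  apply/cvgrPdist_le => eps eps0; near=> n.
  have isn : P.-integrable setT (EFin \o (fun z => `|s n z - g' z|)) by near: n.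
  rewrite -(int_s n).2 -RintegralB//; last exact: (int_s n).1.
  apply: (@le_trans _ _ (`|h| * e n)).
    apply: (le_trans (le_normr_Rintegral _ _)) => //; first exact: int_sg.
    rewrite -RintegralZl//; apply: le_Rintegral => //.
      exact: integrable_norm (int_sg n isn).
    by apply: eq_integrable (integrableZl measurableT `|h| isn) => //= z _; rewrite EFinM.
  near: n; move/cvgrPdist_le : e0h => /(_ _ eps0); apply: filterS => n.
  by rewrite mulr0 sub0r normrN; apply: le_trans; exact: ler_norm.
exact: cvg_unique lim2 lim1.
Unshelve. all: by end_near.
Qed.

End Bochner.

(** * Inequalities between real integrals *)

Section RealIntegrals.
Context {d : measure_display} {T : measurableType d} {R : realType}.
Variable P : probability T R.
Implicit Types g h : T -> R.

Lemma integrableRD g h : P.-integrable setT (EFin \o g) ->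
  P.-integrable setT (EFin \o h) -> P.-integrable setT (EFin \o (fun z => g z + h z)).
Proof. by move=> ig ih; apply: eq_integrable (integrableD _ ig ih). Qed.

Lemma integrableRB g h : P.-integrable setT (EFin \o g) ->
  P.-integrable setT (EFin \o h) -> P.-integrable setT (EFin \o (fun z => g z - h z)).
Proof. by move=> ig ih; apply: eq_integrable (integrableB _ ig ih). Qed.

Lemma integrableRZ (k : R) g : P.-integrable setT (EFin \o g) ->
  P.-integrable setT (EFin \o (fun z => k * g z)).
Proof.
by move=> ig; apply: eq_integrable (integrableZl _ k ig) => // z _; rewrite /= EFinM.
Qed.

Lemma integrableR_cst (k : R) : P.-integrable setT (EFin \o (fun _ : T => k)).
Proof. exact: finite_measure_integrable_cst. Qed.

Lemma Rintegral_cstT (k : R) : \int[P]_(_ in setT) k = k.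
Proof. by rewrite Rintegral_cst// -[X in fine X]/(P setT) probability_setT mulr1. Qed.

(** The upper bound [h] is nonnegative only off the null set, hence the comparison
with its positive part. *)
Lemma ge0_integral_le_Rintegral (N : set T) g h :
  measurable N -> P N = 0%E -> (forall z, 0 <= g z) ->
  (forall z, ~ N z -> g z <= h z) -> P.-integrable setT (EFin \o h) ->
  (\int[P]_z (g z)%:E <= (\int[P]_z h z)%:E)%E.
Proof.
move=> mN N0 g0 gh ih.
have mh : measurable_fun setT h by apply/measurable_EFinP; exact: measurable_int ih.
apply: (@le_trans _ _ (\int[P]_z (Num.max (h z) 0)%:E)%E).
  apply: ae_le_ge0_integral => [z|z|].
  - by rewrite lee_fin.
  - by rewrite lee_fin le_max lexx orbT.
  exists N; split => // z hz; apply: contrapT => /gh ghz; apply: hz.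
  by rewrite /= lee_fin le_max ghz.
rewrite /Rintegral fineK; last exact: integrable_fin_num.
rewrite le_eqVlt; apply/orP; left; apply/eqP.
apply: ae_eq_integral => //.
- by apply/measurable_EFinP; exact: measurable_maxr.
- exact/measurable_EFinP.
exists N; split => // z hz; apply: contrapT => /gh ghz; apply: hz => _.
by rewrite /= max_l// (le_trans (g0 z)).
Qed.

Lemma ae_le_Rintegral (N : set T) g h :
  measurable N -> P N = 0%E -> (forall z, ~ N z -> g z <= h z) ->
  P.-integrable setT (EFin \o g) -> P.-integrable setT (EFin \o h) ->
  \int[P]_z g z <= \int[P]_z h z.
Proof.
move=> mN N0 gh ig ih; rewrite -subr_ge0 -RintegralB// -lee_fin.
have := @ge0_integral_le_Rintegral N (fun _ => 0) (fun z => h z - g z) mN N0.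
rewrite integral0; apply => // [z /gh|]; first by rewrite subr_ge0.
exact: integrableRB.
Qed.

End RealIntegrals.

(** * The expected risk *)

Lemma sqr_dist_continuous {R : realType} {V : normedModType R} (w : V) :
  continuous (fun v : V => `|v - w| ^+ 2 : R).
Proof.
move=> v; apply: (cvgM (f := fun v => `|v - w|) (g := fun v => `|v - w|));
  by apply: cvg_norm; apply: cvgB; [exact: cvg_id|exact: cvg_cst].
Qed.

Section ExpectedRisk.
Context {R : realType} {H : completeNormedModType R} (dot : {dot H for idfun}).
Hypothesis hilbertH : hilbert_dot dot.
Context {dI : measure_display} {I : measurableType dI} (D : probability I R).
Variable fi : I -> H -> R.
Hypothesis fi_integrable : forall x, D.-integrable setT (fun i => (fi i x)%:E).
Let f := expected_fun D fi.
Hypothesis grad_fE : forall x,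
  bochner_expectation D (fun i => grad dot (fi i) x) (grad dot f x).
Variable L : R.
Hypothesis L_gt0 : 0 < L.
Hypothesis fi_convex : forall i, convex_function setT (fi i).
Hypothesis fi_smooth : forall i, smooth dot L (fi i).

Lemma expected_funE x : f x = \int[D]_i fi i x.
Proof. by rewrite /f /expected_fun expectation.unlock. Qed.

Lemma grad_integrable x : exists N g, [/\ measurable N, D N = 0%E,
  strongly_measurable g, (forall i, ~ N i -> g i = grad dot (fi i) x) &
  forall h, D.-integrable setT (EFin \o (fun i => dot (g i) h)) /\
    \int[D]_i dot (g i) h = dot (grad dot f x) h].
Proof.
have [N [mN N0 mg]] := bochner_strongly_measurable (grad_fE x).
have gE i : ~ N i -> (if i \in N then 0 else grad dot (fi i) x) = grad dot (fi i) x.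
  by move=> Ni; rewrite memNset.
exists N, (fun i => if i \in N then 0 else grad dot (fi i) x); split => // h.
exact: (bochner_expectation_dot hilbertH h (grad_fE x) mN N0 gE mg).
Qed.

Lemma expected_fun_ge_tangent x y : f x + dot (grad dot f x) (y - x) <= f y.
Proof.
have [N [g [mN N0 _ gE gint]]] := grad_integrable x.
rewrite !expected_funE -(gint _).2 -RintegralD//;
  [|exact: fi_integrable|exact: (gint _).1].
apply: (ae_le_Rintegral mN N0 _ _ (fi_integrable y)); last first.
  exact: (integrableRD (fi_integrable x) (gint _).1).
by move=> i /gE ->; apply: convex_ge_tangent => //; exact: (fi_smooth i).1.
Qed.

Lemma expected_fun_le_quadratic x y :
  f y <= f x + dot (grad dot f x) (y - x) + L / 2 * `|y - x| ^+ 2.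
Proof.
have [N [g [mN N0 _ gE gint]]] := grad_integrable x.
have i1 := (gint (y - x)).1.
have i2 := integrableRD (fi_integrable x) i1.
have i3 := integrableR_cst D (L / 2 * `|y - x| ^+ 2).
have -> : f x + dot (grad dot f x) (y - x) + L / 2 * `|y - x| ^+ 2 =
    \int[D]_i (fi i x + dot (g i) (y - x) + L / 2 * `|y - x| ^+ 2).
  rewrite (RintegralD measurableT i2 i3) (RintegralD measurableT (fi_integrable x) i1).
  by rewrite Rintegral_cstT (gint _).2 expected_funE.
rewrite expected_funE.
apply: (ae_le_Rintegral mN N0 _ (fi_integrable y) (integrableRD i2 i3)).
by move=> i /gE ->; exact: (smooth_le_quadratic hilbertH x y (fi_smooth i)).
Qed.

(** A step of length [L^-1] against the gradient decreases [f] by at least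
[|grad f|^2 / (2 L)], which is impossible at a minimiser unless the gradient
vanishes. *)
Lemma grad_argmin xs : argmin f xs -> grad dot f xs = 0.
Proof.
move=> xsP; set v := grad dot f xs.
have := expected_fun_le_quadratic xs (xs - L^-1 *: v).
rewrite (addrAC xs) subrr add0r dotNr dotZr normrN normrZ -/v -hilbertH => h.
have {}h := le_trans (xsP _) h.
have Ln : L != 0 by rewrite gt_eqF.
rewrite exprMn real_normK ?num_real// in h.
have E : L / 2 * (L^-1 ^+ 2 * `|v| ^+ 2) = L^-1 * `|v| ^+ 2 / 2 by field.
rewrite {}E in h.
have {}h : L^-1 * `|v| ^+ 2 <= 0 by move: h; set q := L^-1 * _; set F := f xs; lra.
move: h; rewrite pmulr_rle0 ?invr_gt0// => h.
by apply/eqP; rewrite -normr_eq0 -sqrf_eq0 eq_le h sqr_ge0.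
Qed.

(** The gap [f_i y - f_i x - <grad f_i x, y - x>] is almost surely nonnegative and
has mean zero between two minimisers; by cocoercivity it dominates the squared
distance of the two gradients. *)
Lemma grad_argmin_ae_eq x y : argmin f x -> argmin f y ->
  {ae D, forall i, grad dot (fi i) x = grad dot (fi i) y}.
Proof.
move=> xP yP; have [N [g [mN N0 _ gE gint]]] := grad_integrable x.
pose h i := fi i y - fi i x - dot (g i) (y - x).
have ih : D.-integrable setT (EFin \o h).
  exact: (integrableRB (integrableRB (fi_integrable y) (fi_integrable x)) (gint _).1).
have hge i : ~ N i -> (2 * L)^-1 * `|grad dot (fi i) y - grad dot (fi i) x| ^+ 2 <= h i.
  move=> /gE E; rewrite /h E.
  have := smooth_convex_cocoercive hilbertH x y L_gt0 (@fi_convex i) (fi_smooth i).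
  move: (dot _ _) ((2 * L)^-1 * _) (fi i x) (fi i y) => a b p q; lra.
have h0 i : ~ N i -> 0 <= h i.
  by move=> /hge; apply: le_trans; rewrite mulr_ge0 ?sqr_ge0// invr_ge0 mulr_ge0// ltW.
have mh : measurable_fun setT h by apply/measurable_EFinP; exact: measurable_int ih.
have int_h : (\int[D]_i (h i)%:E = 0)%E.
  rewrite -[LHS]fineK; last exact: integrable_fin_num.
  rewrite -/(Rintegral D setT h).
  rewrite (RintegralB _ (integrableRB (fi_integrable y) (fi_integrable x)) (gint _).1)//.
  rewrite (RintegralB _ (fi_integrable y) (fi_integrable x))// (gint _).2.
  rewrite -!expected_funE grad_argmin// linear0l subr0.
  by congr EFin; apply/eqP; rewrite subr_eq0 eq_le xP yP.
have : (\int[D]_i `|(h i)%:E| = 0)%E.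
  rewrite -int_h; apply: ae_eq_integral => //.
  - by apply/measurable_EFinP; exact: measurableT_comp.
  - exact/measurable_EFinP.
  exists N; split => // i hi; apply: contrapT => /h0 Ni; apply: hi => _ /=.
  by rewrite ger0_norm.
move/(ae_eq_integral_abs D measurableT (measurable_int _ ih)).1.
have aeN : {ae D, forall i, ~ N i} by exists N; split => // i /contrapT.
apply: filterS2 aeN => i Ni /(_ Logic.I) /= [hi0].
move: (hge _ Ni); rewrite hi0.
move: (grad dot (fi i) x) (grad dot (fi i) y) => u v.
rewrite pmulr_rle0 ?invr_gt0 ?mulr_gt0// => le0.
by apply/esym/eqP; rewrite -subr_eq0 -normr_eq0 -sqrf_eq0 eq_le le0 sqr_ge0.
Qed.

(** By [grad_argmin_ae_eq] the infimum defining the variance ranges over a single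
value. *)
Lemma gradient_varianceE xs : argmin f xs ->
  solution_gradient_variance dot D fi = (\int[D]_i (`|grad dot (fi i) xs| ^+ 2)%:E)%E.
Proof.
move=> xsP; rewrite /solution_gradient_variance -/f.
rewrite (_ : [set _ | _ in _] = [set (\int[D]_i (`|grad dot (fi i) xs| ^+ 2)%:E)%E]).
  by rewrite ereal_inf1.
apply/seteqP; split => [_ [y yP <-]|_ ->] /=.
  rewrite expectation.unlock; apply: ae_eq_ge0_integral => [i|i|].
  - by rewrite lee_fin sqr_ge0.
  - by rewrite lee_fin sqr_ge0.
  by apply: filterS (grad_argmin_ae_eq yP xsP) => i ->.
by exists xs => //; rewrite expectation.unlock.
Qed.

(** The mean of [sgd_step_le]; the inner product with the gradient at [xs] drops
out since the gradient of [f] vanishes there. *)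
Lemma expected_sgd_step_le (gamma eps : R) x xs :
  argmin f xs -> (solution_gradient_variance dot D fi < +oo)%E ->
  0 < gamma -> gamma * L = 1 -> 0 < eps ->
  (\int[D]_i (`|x - gamma *: grad dot (fi i) x - xs| ^+ 2)%:E
     + (2 * gamma * (1 - eps) * (f x - f xs))%:E <=
   (`|x - xs| ^+ 2)%:E
     + (gamma ^+ 2 * (1 + eps^-1))%:E * solution_gradient_variance dot D fi)%E.
Proof.
move=> xsP; rewrite (gradient_varianceE xsP) => sfin g0 gL e0.
have [N [b [mN N0 mb bE bint]]] := grad_integrable xs.
have sE : (\int[D]_i (`|grad dot (fi i) xs| ^+ 2)%:E = \int[D]_i (`|b i| ^+ 2)%:E)%E.
  apply: ae_eq_ge0_integral => [i|i|]; rewrite ?lee_fin ?sqr_ge0//.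
  by exists N; split => // i hi; apply: contrapT => /bE E; apply: hi; rewrite /= E.
rewrite sE in sfin *.
have ib2 : D.-integrable setT (EFin \o (fun i => `|b i| ^+ 2)).
  apply/integrableP; split.
    apply/measurable_EFinP.
    have := measurable_strongly_measurable mb (@sqr_dist_continuous R H 0).
    by under eq_fun do rewrite subr0.
  by under eq_integral do rewrite /= ger0_norm ?sqr_ge0//.
pose Z i := `|x - xs| ^+ 2 + gamma ^+ 2 * (1 + eps^-1) * `|b i| ^+ 2
  - 2 * gamma * (1 - eps) * (fi i x - fi i xs)
  - 2 * gamma * eps * dot (b i) (x - xs).
have i1 : D.-integrable setT (EFin \o (fun i => gamma ^+ 2 * (1 + eps^-1) * `|b i| ^+ 2)).
  exact: integrableRZ.
have i2 : D.-integrable setT (EFin \o (fun i => fi i x - fi i xs)).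
  exact: (integrableRB (fi_integrable x) (fi_integrable xs)).
have i3 : D.-integrable setT (EFin \o (fun i => 2 * gamma * (1 - eps) * (fi i x - fi i xs))).
  exact: integrableRZ.
have i4 : D.-integrable setT (EFin \o (fun i => 2 * gamma * eps * dot (b i) (x - xs))).
  by apply: integrableRZ; exact: (bint _).1.
have i5 : D.-integrable setT (EFin \o (fun i => `|x - xs| ^+ 2
    + gamma ^+ 2 * (1 + eps^-1) * `|b i| ^+ 2)).
  by apply: integrableRD => //; exact: integrableR_cst.
have i6 := integrableRB i5 i3.
have iZ : D.-integrable setT (EFin \o Z) by exact: integrableRB.
have ZE : \int[D]_i Z i = `|x - xs| ^+ 2
    + gamma ^+ 2 * (1 + eps^-1) * \int[D]_i (`|b i| ^+ 2)
    - 2 * gamma * (1 - eps) * (f x - f xs).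
  rewrite RintegralB// RintegralB// RintegralD//; last exact: integrableR_cst.
  rewrite Rintegral_cstT RintegralZl// RintegralZl// RintegralZl//; last exact: (bint _).1.
  rewrite (RintegralB _ (fi_integrable x) (fi_integrable xs))// (bint _).2.
  by rewrite -!expected_funE grad_argmin// linear0l mulr0 subr0.
have -> : (\int[D]_i (`|b i| ^+ 2)%:E)%E = (\int[D]_i (`|b i| ^+ 2))%:E.
  by rewrite /Rintegral fineK//; exact: integrable_fin_num.
have := @ge0_integral_le_Rintegral _ _ _ D N
  (fun i => `|x - gamma *: grad dot (fi i) x - xs| ^+ 2) Z mN N0.
rewrite ZE => /(_ (fun i => sqr_ge0 _)) le1.
rewrite -leeBrDr//; apply: le1 => // i /bE E.
by rewrite /Z E; exact: (sgd_step_le hilbertH x xs L_gt0 g0 gL e0 (@fi_convex i) (fi_smooth i)).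
Qed.

End ExpectedRisk.

(** * Independence of the past *)

Section Independence.
Context {dO dY dI : measure_display} {Om : measurableType dO}
  {Y : measurableType dY} {I : measurableType dI} {R : realType}.
Variables (P : probability Om R) (D : probability I R).

(** Under independence the joint law of [W] and [X] is the product of their laws,
so that Tonelli's theorem applies. *)
Lemma integral_independent (W : Om -> Y) (X : Om -> I) (psi : Y * I -> \bar R) :
  measurable_fun setT W -> measurable_fun setT X ->
  (forall A B, measurable A -> measurable B ->
    P (W @^-1` A `&` X @^-1` B) = (P (W @^-1` A) * D B)%E) ->
  measurable_fun setT psi -> (forall z, 0 <= psi z)%E ->
  (\int[P]_w psi (W w, X w) = \int[P]_w \int[D]_i psi (W w, i))%E.
Proof.
move=> mW mX WX mpsi psi0.
have mWX : measurable_fun setT (fun w => (W w, X w)) by exact: measurable_fun_pair.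
pose Wf : {mfun Om >-> Y} := HB.pack W (isMeasurableFun.Build _ _ _ _ _ mW).
pose WXf : {mfun Om >-> (Y * I)%type} :=
  HB.pack (fun w => (W w, X w)) (isMeasurableFun.Build _ _ _ _ _ mWX).
transitivity (\int[distribution P WXf]_z psi z)%E.
  by rewrite ge0_integral_distribution.
transitivity (\int[distribution P Wf \x D]_z psi z)%E.
  apply: eq_measure_integral => A mA _; apply/esym.
  by apply: product_measure_unique => // B C mB mC; rewrite -WX.
rewrite fubini_tonelli1// ge0_integral_distribution//.
  exact: measurable_fun_fubini_tonelli_F.
by move=> y; exact: integral_ge0.
Qed.

End Independence.

Section History.
Context {dO dI : measure_display} {Om : measurableType dO}
  {I : measurableType dI} {R : realType}.
Variables (P : probability Om R) (D : probability I R) (idx : nat -> {RV P >-> I}).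

(** A pi-system generating the sigma-algebra of the first [t] indices. *)
Definition cylinders (t : nat) : set (set Om) :=
  [set A | exists2 B : nat -> set I, (forall s, measurable (B s)) &
     A = \bigcap_(s in `I_t) (idx s @^-1` B s)].

(** The sample space seen at time [t]: same points, but only the events determined
by the first [t] indices are measurable. *)
Definition history (t : nat) := g_sigma_algebraType (cylinders t).

Lemma cylinders_measurable t : cylinders t `<=` measurable.
Proof.
move=> _ [B mB ->]; apply: bigcap_measurableType => s _.
by rewrite -[X in measurable X]setTI; exact: measurable_funP.
Qed.

Lemma cylinders_setI t : setI_closed (cylinders t).
Proof.
move=> _ _ [B mB ->] [C mC ->]; exists (fun s => B s `&` C s).
  by move=> s; exact: measurableI.
by rewrite -bigcapI.
Qed.

Lemma measurable_to_history t : @measurable_fun _ _ Om (history t) setT id.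
Proof.
apply: (@measurability _ _ Om (history t) setT id (cylinders t)) => // _ [A cA <-].
by rewrite setTI preimage_id; exact: cylinders_measurable cA.
Qed.

Lemma measurable_history_pred t : @measurable_fun _ _ (history t.+1) (history t) setT id.
Proof.
apply: (@measurability _ _ (history t.+1) (history t) setT id (cylinders t)) => //.
move=> _ [_ [B mB ->] <-].
rewrite setTI preimage_id; apply: sub_sigma_algebra.
exists (fun s => if (s < t)%N then B s else setT).
  by move=> s; case: ifP.
apply/seteqP; split => w /= Bw s /=.
  by case: ifP => // st _; exact: Bw.
by move=> st; have /= := Bw s (ltnW st); rewrite st.
Qed.

Lemma measurable_history_last t : @measurable_fun _ _ (history t.+1) I setT (idx t).
Proof.
move=> _ B mB; rewrite setTI; apply: sub_sigma_algebra.
exists (fun s => if s == t then B else setT) => [s|]; first by case: ifP.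
apply/seteqP; split => w /= Bw; first by move=> s /= _; case: eqP => // ->.
by have /= := Bw t (ltnSn t); rewrite eqxx.
Qed.

Hypothesis idx_iid : iid D idx.

(** The product rule holds on cylinders by hypothesis and extends to the
sigma-algebra they generate by uniqueness of finite measures that agree on a
pi-system. *)
Lemma history_independent t (A : set (history t)) (B : set I) :
  measurable A -> measurable B ->
  P (A `&` idx t @^-1` B) = (P A * D B)%E.
Proof.
move=> mA mB; have [lawD indep] := idx_iid.
have mXB : measurable (idx t @^-1` B).
  by rewrite -[X in measurable X]setTI; exact: measurable_funP.
have DB : D B = (fine (D B))%:E by rewrite fineK// fin_num_measure.
have DB0 : 0 <= fine (D B) by rewrite fine_ge0.
(* both sides of the product rule are finite measures as functions of A *)
suff : mrestr P mXB A = mscale (NngNum DB0) P A.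
  by rewrite /mrestr /mscale /= => ->; rewrite [RHS]muleC [in RHS]DB.
apply: (@g_sigma_algebra_measure_unique _ _ _ (cylinders t) (@cylinders_measurable t)
  (fun _ => setT)) => //.
- move=> _; exists (fun _ => setT) => //; apply/seteqP; split => // w _ s _ //.
- by rewrite bigcup_const//; exists 0%N.
- exact: cylinders_setI.
- move=> _ [C mC ->].
  rewrite -[LHS]/(P ((\bigcap_(s in `I_t) (idx s @^-1` C s)) `&` (idx t @^-1` B))).
  rewrite -[RHS]/((fine (D B))%:E * P (\bigcap_(s in `I_t) (idx s @^-1` C s)))%E -DB.
  (* constraining coordinate t by B yields an event on the first t + 1 indices *)
  pose C' s := if s == t then B else C s.
  have mC' s : measurable (C' s) by rewrite /C'; case: ifP.
  have setJ n : [set` fset_set `I_n] = `I_n by rewrite fset_setK//; exact: finite_II.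
  have JS : fset_set `I_t.+1 = (t |` fset_set `I_t)%fset.
    apply/fsetP => s; rewrite !inE !in_fset_set; try exact: finite_II.
    apply/idP/orP => [/set_mem /=|].
      by rewrite ltnS leq_eqVlt => /orP[/eqP->|st]; [left|right; exact/mem_set].
    by move=> [/eqP ->|/set_mem /= st]; apply/mem_set => //=; exact: ltnW.
  have tJ : t \notin fset_set `I_t.
    by rewrite in_fset_set ?notin_setE /= ?ltnn//; exact: finite_II.
  have CC' : \bigcap_(s in `I_t) (idx s @^-1` C s) = \bigcap_(s in `I_t) (idx s @^-1` C' s).
    by apply: eq_bigcapr => s /= st; rewrite /C' ltn_eqF.
  have -> : (\bigcap_(s in `I_t) (idx s @^-1` C s)) `&` (idx t @^-1` B) =
      \bigcap_(s in `I_t.+1) (idx s @^-1` C' s).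
    rewrite CC'; apply/seteqP; split => w /=.
      move=> [h hB] s /=; rewrite ltnS leq_eqVlt => /orP[/eqP ->|st]; last exact: h.
      by rewrite /C' eqxx.
    by move=> h; split => [s st|]; [exact/h/ltnW|have := h t (ltnSn t); rewrite /C' eqxx].
  rewrite CC' -setJ -(setJ t) !indep// JS big_fsetU1//=.
  by congr (_ * _)%E; rewrite /C' eqxx; exact: lawD.
- by move=> _; rewrite -[ltLHS]/(P (setT `&` (idx t @^-1` B))) setTI ltey_eq fin_num_measure.
Qed.

End History.

(** * Stochastic gradient descent *)

Lemma lipschitzT_continuous {R : realType} {V W : normedModType R} (L : R) (g : V -> W) :
  0 < L -> L.-lipschitz g -> continuous g.
Proof.
move=> L0 gL u; apply/cvgrPdist_le => e e0; near=> v.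
apply: (le_trans (gL (u, v) (conj Logic.I Logic.I))) => /=.
rewrite mulrC -ler_pdivlMr//; near: v.
by apply: cvgr_dist_le; [exact: cvg_id|rewrite divr_gt0].
Unshelve. all: by end_near.
Qed.

Section SGDStep.
Context {R : realType} {H : completeNormedModType R} (dot : {dot H for idfun}).
Hypothesis hilbertH : hilbert_dot dot.
Context {dI : measure_display} {I : measurableType dI} (D : probability I R).
Variable fi : I -> H -> R.
Hypothesis fi_integrable : forall x, D.-integrable setT (fun i => (fi i x)%:E).
Let f := expected_fun D fi.
Hypothesis f_diff : forall x, differentiable f x.
Hypothesis grad_fE : forall x,
  bochner_expectation D (fun i => grad dot (fi i) x) (grad dot f x).
Variable L : R.
Hypothesis L_gt0 : 0 < L.
Hypothesis fi_convex : forall i, convex_function setT (fi i).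
Hypothesis fi_smooth : forall i, smooth dot L (fi i).

(** The exceptional set [N] is the union of those of [grad f_i] at the countably
many points approximating [x']; off [N], continuity of the gradients carries
measurability over to all the values of [x']. *)
Lemma gradient_along_strongly_measurable {dY : measure_display}
    {Y : measurableType dY} (x' : Y -> H) :
  strongly_measurable x' -> exists N (G : Y * I -> H),
  [/\ measurable N, D N = 0%E, strongly_measurable G &
      forall y i, ~ N i -> G (y, i) = grad dot (fi i) (x' y)].
Proof.
move=> [c xc].
have /choice[Nk NkP] k : exists N, [/\ measurable N, D N = 0%E &
    strongly_measurable (fun i => if i \in N then 0 else grad dot (fi i) (c k))].
  exact: bochner_strongly_measurable (grad_fE (c k)).
pose N := \bigcup_k Nk k.
have mN : measurable N by apply: bigcup_measurable => k _; have [] := NkP k.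
have N0 : D N = 0%E.
  apply/negligibleP => //; apply: negligible_bigcup => k.
  by have [mk k0 _] := NkP k; apply/negligibleP.
exists N, (fun z => if z.2 \in N then 0 else grad dot (fi z.2) (x' z.1)); split => //.
  apply: (strongly_measurable_caratheodory
    (Phi := fun u (z : Y * I) => if z.2 \in N then 0 else grad dot (fi z.2) u)
    (strongly_measurable_to_comp xc measurable_fst)) => [z|k].
    case: (z.2 \in N); first by move=> u; exact: cvg_cst.
    exact: lipschitzT_continuous L_gt0 (fi_smooth z.2).2.
  have [mk k0 smk] := NkP k.
  have := strongly_measurable_comp (strongly_measurable_off mN smk)
    (measurable_snd : measurable_fun setT (snd : Y * I -> I)).
  congr strongly_measurable; apply/funext => z /=.
  case: ifPn => // zN; rewrite memNset// => Nz; move/negP: zN; apply.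
  by apply/mem_set; exists k.
by move=> y i Ni /=; rewrite memNset.
Qed.

Variable xs : H.
Hypothesis xs_argmin : argmin f xs.
Hypothesis sigma_fin : (solution_gradient_variance dot D fi < +oo)%E.
Variables gamma eps : R.
Hypothesis gamma_gt0 : 0 < gamma.
Hypothesis gammaL : gamma * L = 1.
Hypothesis eps_gt0 : 0 < eps.
Hypothesis eps_lt1 : eps < 1.
Context {dO : measure_display} {Om : measurableType dO} (P : probability Om R).
Variable idx : nat -> {RV P >-> I}.
Hypothesis idx_iid : iid D idx.
Variable x0 : H.
Let x := sgd dot fi gamma x0 (fun t w => idx t w).

Lemma ae_notin_idx t N : measurable N -> D N = 0%E ->
  {ae P, forall w, ~ N (idx t w)}.
Proof.
move=> mN N0; exists (idx t @^-1` N); split.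
- by rewrite -[X in measurable X]setTI; exact: measurable_funP.
- by rewrite -N0 -(idx_iid.1 t N mN).
- by move=> w /contrapT.
Qed.

(** The version at time [t] depends on the first [t] indices only, in the sense
that it is strongly measurable for the history. *)
Lemma sgd_strongly_measurable t : exists x' : history idx t -> H,
  strongly_measurable x' /\ {ae P, forall w, x t w = x' w}.
Proof.
elim: t => [|t [x' [mx' xx']]].
  exists (fun _ => x0); split; first exact: strongly_measurable_cst.
  exact: aeW.
have [N [G [mN N0 mG GE]]] := gradient_along_strongly_measurable mx'.
exists (fun w => x' w - gamma *: G ((w : history idx t), idx t w)); split.
  apply: strongly_measurable_subZ.
    exact: (strongly_measurable_comp mx' (@measurable_history_pred _ _ _ _ _ _ idx t)).
  apply: (strongly_measurable_comp
    (p := fun w : history idx t.+1 => ((w : history idx t), idx t w)) mG).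
  apply: measurable_fun_pair; first exact: measurable_history_pred.
  exact: measurable_history_last.
apply: filterS2 xx' (ae_notin_idx t mN N0) => w xw Nw.
transitivity (x t w - gamma *: grad dot (fi (idx t w)) (x t w)); first by [].
by rewrite xw (GE _ _ Nw).
Qed.

(** The inner integral over a fresh index is bounded by [expected_sgd_step_le] at
each value of the current iterate. *)
Lemma sgd_expected_step t :
  (\int[P]_w (`|x t.+1 w - xs| ^+ 2)%:E
     + (2 * gamma * (1 - eps))%:E * \int[P]_w (f (x t w) - f xs)%:E <=
   \int[P]_w (`|x t w - xs| ^+ 2)%:E
     + (gamma ^+ 2 * (1 + eps^-1))%:E * solution_gradient_variance dot D fi)%E.
Proof.
have [x' [mx' xx']] := sgd_strongly_measurable t.
have [N [G [mN N0 mG GE]]] := gradient_along_strongly_measurable mx'.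
have mid := @measurable_to_history _ _ _ _ _ _ idx t.
pose xO : Om -> H := x'.
have mxO : strongly_measurable xO by exact: (strongly_measurable_comp mx' mid).
have k0 : 0 <= 2 * gamma * (1 - eps).
  by rewrite mulr_ge0// ?subr_ge0 ?ltW// mulr_gt0.
have c0 : 0 <= gamma ^+ 2 * (1 + eps^-1).
  by rewrite mulr_ge0 ?sqr_ge0// addr_ge0// invr_ge0 ltW.
have fge y : 0 <= f y - f xs by rewrite subr_ge0; exact: xs_argmin.
have s0 : (0 <= solution_gradient_variance dot D fi)%E.
  rewrite (gradient_varianceE hilbertH fi_integrable grad_fE L_gt0 fi_convex fi_smooth
    xs_argmin).
  by apply: integral_ge0 => i _; rewrite lee_fin sqr_ge0.
pose psi (z : history idx t * I) := (`|x' z.1 - gamma *: G z - xs| ^+ 2)%:E.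
have psi0 z : (0 <= psi z)%E by rewrite lee_fin sqr_ge0.
have mpsi : measurable_fun setT psi.
  apply/measurable_EFinP.
  apply: (measurable_strongly_measurable (g := fun z => x' z.1 - gamma *: G z)
    _ (@sqr_dist_continuous R H xs)).
  apply: strongly_measurable_subZ mG.
  exact: (strongly_measurable_comp mx' measurable_fst).
pose q (w : Om) := (\int[D]_i psi ((w : history idx t), i))%E.
have q0 w : (0 <= q w)%E by apply: integral_ge0 => i _; exact: psi0.
have mq : measurable_fun setT q.
  have mF := @measurable_fun_fubini_tonelli_F _ _ (history idx t) I R D psi mpsi psi0.
  exact: (measurableT_comp mF mid).
have uS : (\int[P]_w (`|x t.+1 w - xs| ^+ 2)%:E = \int[P]_w q w)%E.
  rewrite -(@integral_independent _ _ _ _ _ _ _ P D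
    (id : Om -> history idx t) (idx t) psi)//.
    apply: ae_eq_ge0_integral => [w|w|]; rewrite ?lee_fin ?sqr_ge0//.
    apply: filterS2 xx' (ae_notin_idx t mN N0) => w xw Nw.
    transitivity (`|x t w - gamma *: grad dot (fi (idx t w)) (x t w) - xs| ^+ 2)%:E; first by [].
    by rewrite xw /psi (GE _ _ Nw).
  by move=> A B mA mB; exact: history_independent.
have u_t : (\int[P]_w (`|x t w - xs| ^+ 2)%:E = \int[P]_w (`|xO w - xs| ^+ 2)%:E)%E.
  apply: ae_eq_ge0_integral => [w|w|]; rewrite ?lee_fin ?sqr_ge0//.
  by apply: filterS xx' => w ->.
have v_t : (\int[P]_w (f (x t w) - f xs)%:E = \int[P]_w (f (xO w) - f xs)%:E)%E.
  apply: ae_eq_ge0_integral => [w|w|]; rewrite ?lee_fin//.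
  by apply: filterS xx' => w ->.
have mf : measurable_fun setT (fun w => (f (xO w) - f xs)%:E).
  apply/measurable_EFinP; apply: (measurable_strongly_measurable (phi := fun y => f y - f xs) mxO).
  move=> y; apply: cvgB; last exact: cvg_cst.
  exact: differentiable_continuous.
have mu : measurable_fun setT (fun w => (`|xO w - xs| ^+ 2)%:E).
  apply/measurable_EFinP; exact: (measurable_strongly_measurable mxO (@sqr_dist_continuous R H xs)).
rewrite uS u_t v_t -ge0_integralZl//; last by move=> w _; rewrite lee_fin.
rewrite -ge0_integralD//; first last.
- exact: measurable_funeM.
- by move=> w _; rewrite mule_ge0 ?lee_fin.
set S := (X in (_ <= _ + X)%E).
have S0 : (0 <= S)%E by rewrite mule_ge0.
have -> : S = (\int[P]_w S)%E.
  by rewrite integral_cst// -[X in (_ * X)%E]/(P setT) probability_setT mule1.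
rewrite -ge0_integralD//.
apply: ae_le_ge0_integral => [w|w|].
- by rewrite adde_ge0// mule_ge0 ?lee_fin.
- by rewrite adde_ge0// lee_fin sqr_ge0.
apply: aeW => w.
rewrite -EFinM.
have -> : q w = (\int[D]_i (`|xO w - gamma *: grad dot (fi i) (xO w) - xs| ^+ 2)%:E)%E.
  apply: ae_eq_ge0_integral => [i|i|]; rewrite ?lee_fin ?sqr_ge0//.
  exists N; split => // i hi; apply: contrapT => /(GE w) E; apply: hi.
  by rewrite /= /psi E.
exact: (expected_sgd_step_le hilbertH fi_integrable grad_fE L_gt0 fi_convex fi_smooth
  (xO w) xs_argmin sigma_fin gamma_gt0 gammaL eps_gt0).
Qed.

End SGDStep.

Lemma minvalE {R : realType} {H : completeNormedModType R} (f : H -> R) xs :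
  argmin f xs -> minval f = f xs.
Proof.
move=> xsP; apply/eqP; rewrite eq_le; apply/andP; split.
  by apply: ge_inf; [exists (f xs) => _ [y _ <-]; exact: xsP|exists xs].
by apply: lb_le_inf; [exists (f xs), xs|move=> _ [y _ <-]; exact: xsP].
Qed.

(** Jensen's inequality for a finite average: the linear terms of the subgradient
inequalities at the average cancel. *)
Lemma subgradient_average_le {R : realType} {H : completeNormedModType R}
    (dot : {dot H for idfun}) (f : H -> R) (y : nat -> H) (T : nat) (g : H) :
  (0 < T)%N ->
  let z := T%:R^-1 *: \sum_(0 <= t < T) y t in
  (forall u, f z + dot g (u - z) <= f u) ->
  f z <= T%:R^-1 * \sum_(0 <= t < T) f (y t).
Proof.
move=> T0 z fz.
have T1 : (T%:R : R) != 0 by rewrite pnatr_eq0 -lt0n.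
rewrite -ler_pdivrMl ?invr_gt0 ?ltr0n// invrK.
have : \sum_(0 <= t < T) (f z + dot g (y t - z)) <= \sum_(0 <= t < T) f (y t).
  exact: ler_sum.
rewrite big_split /= sumr_const_nat subn0 -[f z *+ T]mulr_natl.
suff -> : \sum_(0 <= t < T) dot g (y t - z) = 0 by rewrite addr0.
have -> : \sum_(0 <= t < T) dot g (y t - z) = dot g (\sum_(0 <= t < T) (y t - z)).
  elim/big_rec2 : _ => [|t u v _ ->]; first by rewrite linear0r.
  by rewrite -dotDr.
rewrite sumrB sumr_const_nat subn0 -scaler_nat /z scalerA divff// scale1r subrr.
exact: linear0r.
Qed.

Theorem theorem4p4
  (R : realType) (H : completeNormedModType R) (dot : {dot H for idfun})
  (hilbertH : hilbert_dot dot)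
  (dI : measure_display) (I : measurableType dI) (D : probability I R)
  (fi : I -> H -> R)
  (fi_diff : forall i x, differentiable (fi i) x)
  (fi_integrable : forall x, D.-integrable setT (fun i => (fi i x)%:E))
  (f : H -> R) (fE : f = expected_fun D fi)
  (argmin_nonempty : argmin f !=set0)
  (f_diff : forall x, differentiable f x)
  (grad_fE : forall x,
    bochner_expectation D (fun i => grad dot (fi i) x) (grad dot f x))
  (L : R) (L_gt0 : 0 < L)
  (fi_convex : forall i, convex_function setT (fi i))
  (fi_smooth : forall i, smooth dot L (fi i))
  (sigma_fin : (solution_gradient_variance dot D fi < +oo)%E)
  (gamma : R) (gamma_gt0 : 0 < gamma) (gammaL : gamma * L = 1)
  (dO : measure_display) (Om : measurableType dO) (P : probability Om R)
  (idx : nat -> {RV P >-> I}) (idx_iid : iid D idx)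
  (x0 : H) (x : nat -> Om -> H)
  (xE : x = sgd dot fi gamma x0 (fun t w => idx t w))
  (xs : H) (xs_argmin : argmin f xs)
  (eps : R) (eps_gt0 : 0 < eps) (eps_lt1 : eps < 1)
  (T : nat) (T_ge1 : (1 <= T)%N) :
  ('E_P[fun w => (f (average x T w) - minval f)%R]
     <= (T%:R^-1)%:E * \sum_(0 <= t < T) 'E_P[fun w => (f (x t w) - minval f)%R])%E
  /\
  ((T%:R^-1)%:E * \sum_(0 <= t < T) 'E_P[fun w => (f (x t w) - minval f)%R]
     <= (`|x0 - xs| ^+ 2 / (2 * (1 - eps) * gamma * T%:R))%:E
        + ((1 + eps) / (2 * eps * (1 - eps)) * gamma)%:E
          * solution_gradient_variance dot D fi)%E.
Proof.
subst f x.
rewrite (minvalE xs_argmin).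
set f := expected_fun D fi in f_diff grad_fE xs_argmin argmin_nonempty *.
set X := sgd dot fi gamma x0 (fun t w => idx t w).
pose v t := (\int[P]_w (f (X t w) - f xs)%:E)%E.
have fge y : 0 <= f y - f xs by rewrite subr_ge0; exact: xs_argmin.
have v0 t : (0 <= v t)%E by apply: integral_ge0 => w _; rewrite lee_fin.
have -> : (\sum_(0 <= t < T) 'E_P[fun w => (f (X t w) - f xs)%R] = \sum_(0 <= t < T) v t)%E.
  by apply: eq_bigr => t _; rewrite expectation.unlock.
have T0 : 0 < T%:R :> R by rewrite ltr0n.
split.
- have /choice[y yP] t : exists y : Om -> H,
      strongly_measurable y /\ {ae P, forall w, X t w = y w}.
    have [x' [mx' xx']] := sgd_strongly_measurable grad_fE L_gt0 fi_smooth gamma idx_iid x0 t.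
    exists x'; split => //.
    exact: (strongly_measurable_comp mx' (@measurable_to_history _ _ _ _ _ _ idx t)).
  have mf t : measurable_fun setT (fun w => (f (y t w) - f xs)%:E).
    apply/measurable_EFinP.
    apply: (measurable_strongly_measurable (phi := fun u => f u - f xs) (yP t).1) => u.
    by apply: cvgB; [exact: differentiable_continuous|exact: cvg_cst].
  have -> : (\sum_(0 <= t < T) v t =
      \int[P]_w \sum_(0 <= t < T) (f (y t w) - f xs)%:E)%E.
    rewrite ge0_integral_sum//; last by move=> t w _; rewrite lee_fin.
    apply: eq_bigr => t _; apply: ae_eq_ge0_integral => [w|w|]; rewrite ?lee_fin//.
    by apply: filterS (yP t).2 => w ->.
  rewrite -ge0_integralZl//; first last.
  + by move=> w _; apply: sume_ge0 => t _; rewrite lee_fin.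
  + exact: emeasurable_sum.
  rewrite expectation.unlock; apply: ae_le_ge0_integral => [w|w|].
  + by rewrite lee_fin.
  + by rewrite mule_ge0 ?lee_fin ?invr_ge0 ?(ltW T0)// sume_ge0// => t _; rewrite lee_fin.
  have := ae_foralln (fun t => (yP t).2); apply: filterS => w Xy.
  rewrite sumEFin -EFinM lee_fin sumrB sumr_const_nat subn0 mulrBr -[f xs *+ T]mulr_natl.
  rewrite mulKf ?gt_eqF// lerB//.
  under eq_bigr do rewrite -Xy.
  apply: (@subgradient_average_le _ _ dot f (X ^~ w) T
    (grad dot f (average X T w)) T_ge1) => u.
  exact: (expected_fun_ge_tangent hilbertH fi_integrable grad_fE fi_convex fi_smooth _ _).
set sig := solution_gradient_variance dot D fi.
have sig0 : (0 <= sig)%E.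
  rewrite /sig (gradient_varianceE hilbertH fi_integrable grad_fE L_gt0 fi_convex fi_smooth
    xs_argmin).
  by apply: integral_ge0 => i _; rewrite lee_fin sqr_ge0.
have sigE : sig = (fine sig)%:E by rewrite fineK// ge0_fin_numE.
pose k := 2 * gamma * (1 - eps).
pose c := gamma ^+ 2 * (1 + eps^-1).
have k0 : 0 < k by rewrite !mulr_gt0// subr_gt0.
have telescope n : (\int[P]_w (`|X n w - xs| ^+ 2)%:E + k%:E * \sum_(0 <= t < n) v t <=
    (`|x0 - xs| ^+ 2 + n%:R * (c * fine sig))%:E)%E.
  elim: n => [|n IH].
    rewrite big_nil mule0 adde0 mul0r addr0.
    rewrite -[leLHS]/(\int[P]_w (cst (`|x0 - xs| ^+ 2)%:E) w)%E.
    by rewrite integral_cst// -[X in (_ * X)%E]/(P setT) probability_setT mule1.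
  rewrite big_nat_recr//= ge0_muleDr//; last by apply: sume_ge0 => t _.
  have step := @sgd_expected_step _ _ _ hilbertH _ _ D fi fi_integrable f_diff grad_fE L L_gt0
    fi_convex fi_smooth xs xs_argmin sigma_fin gamma eps gamma_gt0 gammaL eps_gt0 eps_lt1
    _ _ P idx idx_iid x0 n.
  rewrite addeCA; apply: (le_trans (leeD2l _ step)).
  rewrite addeA (addeC (k%:E * _)%E); apply: (le_trans (leeD2r _ IH)).
  rewrite -/sig -/c sigE -EFinM -EFinD lee_fin.
  by rewrite -natr1 mulrDl mul1r addrA.
have sum_le : (\sum_(0 <= t < T) v t <=
    (k^-1)%:E * (`|x0 - xs| ^+ 2 + T%:R * (c * fine sig))%:E)%E.
  rewrite lee_pdivlMl//; apply: le_trans (telescope T).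
  by rewrite leeDr// integral_ge0// => w _; rewrite lee_fin sqr_ge0.
apply: (le_trans (lee_wpmul2l _ sum_le)); first by rewrite lee_fin invr_ge0 ltW.
rewrite sigE -!EFinM -EFinD lee_fin /k /c le_eqVlt; apply/orP; left; apply/eqP.
have ? : gamma != 0 by rewrite gt_eqF.
have ? : eps != 0 by rewrite gt_eqF.
have ? : T%:R != 0 :> R by rewrite gt_eqF.
have ? : 1 - eps != 0 by rewrite subr_eq0 gt_eqF.
by field; apply/and4P.
Qed.
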